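(* Let $\varepsilon\in\left(\omega\left(\sqrt{\frac{\log n}{n}}\right),0.001\right)$. For every randomized algorithm $\Pi$ in the adjacency-matrix query model, if on every $n$-vertex input graph the algorithm outputs, with probability $>1/100$, a cut whose size is at least the maximum cut size minus $\varepsilon n^2$ (respectively, a bisection whose size is at most the minimum bisection size plus $\varepsilon n^2$), then the worst-case query complexity of $\Pi$ is $\Omega(n/\varepsilon^2)$.
   Context: A cut is $P\in\{0,1\}^n$ splitting $V$ ($|V|=n$) into $V_0=\{v:P_v=0\}$, $V_1=\{v:P_v=1\}$; $\mathrm{cut}_G(P)$ is the number of edges between them; the max cut size is $\max_P\mathrm{cut}_G(P)$. For even $n$ a bisection is a cut with exactly $n/2$ ones, and the minimum bisection size is the minimum of $\mathrm{cut}_G$ over bisections. In the adjacency-matrix query model the algorithm adaptively queries pairs $\{u,v\}$ and learns whether $\{u,v\}\in E$. *)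

(* Defs.v *)
From HB Require Import structures.
From mathcomp Require Import all_boot all_order all_algebra.
From mathcomp Require Import all_classical all_reals all_analysis.

Set Implicit Arguments.
Unset Strict Implicit.
Unset Printing Implicit Defensive.

Import Order.TTheory GRing.Theory Num.Theory.

(* Unordered pairs {u, v} of distinct vertices of V = 'I_n. *)
Notation vpair n := {e : {set 'I_n} | #|e| == 2}.

(* A simple graph on the vertex set 'I_n is given by its edge set. *)
Notation sgraph n := {set vpair n}.

Notation vcut n := {ffun 'I_n -> bool}.

Section Cuts.
Variable n : nat.
Implicit Types (G : sgraph n) (P : vcut n).

Definition V0 P : {set 'I_n} := [set v : 'I_n | P v == false].
Definition V1 P : {set 'I_n} := [set v : 'I_n | P v == true].

Definition crosses P (e : {set 'I_n}) : bool :=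
  (e :&: V0 P != finset.set0) && (e :&: V1 P != finset.set0).

Definition cut_size G P : nat := #|[set e in G | crosses P (val e)]|.

Definition max_cut G : nat := \max_(P : vcut n) cut_size G P.

(* 2 * #|V1 P| = n, so there is no bisection when n is odd. *)
Definition bisection P : bool := (#|V1 P|.*2 == n)%N.

(* Every cut has size at most #|G|, so for even n the default value #|G| does
   not affect the minimum. *)
Definition min_bisection G : nat :=
  \big[minn/#|G|]_(P : vcut n | bisection P) cut_size G P.

(* Deterministic adaptive algorithms: [Query e t0 t1] queries the pair e and
   continues as t1 if e is an edge, as t0 otherwise. *)
Inductive dtree : Type :=
  | Output of vcut n
  | Query of vpair n & dtree & dtree.

Fixpoint output (t : dtree) G : vcut n :=
  match t with
  | Output P => P
  | Query e t0 t1 => if e \in G then output t1 G else output t0 G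
  end.

Fixpoint queries (t : dtree) G : nat :=
  match t with
  | Output _ => 0%N
  | Query e t0 t1 => (if e \in G then queries t1 G else queries t0 G).+1
  end.

End Cuts.

Local Open Scope classical_set_scope.
Local Open Scope ring_scope.

(* A random decision tree on an arbitrary probability space of coins. There are
   countably many trees, so measurability is with respect to the discrete
   sigma-algebra. *)
Record rand_algorithm (R : realType) (n : nat) := RandAlgorithm {
  coin_display : measure_display;
  coins : measurableType coin_display;
  coin_law : probability coins R;
  coin_tree : coins -> dtree n;
  coin_tree_measurable :
    forall A : set (dtree n), measurable (coin_tree @^-1` A)
}.

Arguments coin_tree {R n} r w.

Section Algorithms.
Variables (R : realType) (n : nat) (Pi : rand_algorithm R n).

Definition output_prob (G : sgraph n) (good : vcut n -> Prop) : \bar R :=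
  coin_law Pi [set w | good (output (coin_tree Pi w) G)].

(* Worst case over both the input graph and the coins. *)
Definition query_complexity : \bar R :=
  ereal_sup [set x : \bar R | exists (w : coins Pi) (G : sgraph n),
                                x = ((queries (coin_tree Pi w) G)%:R)%:E].

Definition near_max_cut (eps : R) (G : sgraph n) (P : vcut n) : Prop :=
  (max_cut G)%:R - eps * n%:R ^+ 2 <= (cut_size G P)%:R :> R.

Definition near_min_bisection (eps : R) (G : sgraph n) (P : vcut n) : Prop :=
  bisection P /\
  (cut_size G P)%:R <= (min_bisection G)%:R + eps * n%:R ^+ 2 :> R.

Definition solves_max_cut (eps : R) : Prop :=
  forall G : sgraph n,
    ((1 / 100)%:E < output_prob G (near_max_cut eps G))%E.

Definition solves_min_bisection (eps : R) : Prop :=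
  forall G : sgraph n,
    ((1 / 100)%:E < output_prob G (near_min_bisection eps G))%E.

End Algorithms.

(* Main.v *)
Require Import Defs.
From HB Require Import structures.
From mathcomp Require Import all_boot all_order all_algebra.
From mathcomp Require Import all_classical all_reals all_analysis.
From mathcomp Require Import measurable_realfun ring lra.

(** Plant a uniformly random cut x with n./2 ones and let each pair be an edge
independently, with probability 1/2 + 32 eps if x separates it and 1/2 - 32 eps
otherwise (signs exchanged for the bisection problem). The mean size of a cut P
is affine in <x, P>^2, where cuts are read as sign vectors, and Hoeffding with a
union bound controls the deviations of all 2^n cuts at once because
eps^2 n >= 8. Hence a near-optimal P has <x, P>^2 >= n^2 / 2.

For a deterministic tree with at most q queries, the probability of any event on
its output under the planted measure is at most the square root of
(1 + 4 (32 eps)^2)^q times its probability under the uniform measure. Under the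
latter the output is independent of x, so <x, P>^2 >= n^2 / 2 has probability at
most 2 (n + 1) exp(- n / 18), the factor n + 1 paying for x being balanced. If
q <= c n / eps^2 with c small the product is exponentially small. Averaging over
the coins gives the randomized bound. *)

Set Implicit Arguments.
Unset Strict Implicit.
Unset Printing Implicit Defensive.

Import Order.TTheory GRing.Theory Num.Theory.
Import numFieldNormedType.Exports.
Local Open Scope ring_scope.

(** * Product measures on the subsets of a finite type *)

Section ProductMeasure.
Variables (R : realType) (T : finType).
Implicit Types (a c : T -> R) (F : {set T} -> R).

(** The law in which each [e] belongs to [G] independently with probability [a e]. Conditioning on
    the status of a pair sets [a e] to 0 or 1 and stays within this family. *)
Definition wt a (G : {set T}) : R :=
  \prod_e (if e \in G then a e else 1 - a e).

Definition Ex a F : R := \sum_G wt a G * F G.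

Definition upd a (e : T) (v : R) : T -> R := fun i => if i == e then v else a i.

Lemma Ex_prod a (f g : T -> R) :
  Ex a (fun G => \prod_e (if e \in G then f e else g e)) =
  \prod_e (a e * f e + (1 - a e) * g e).
Proof.
rewrite bigA_distr; apply: eq_bigr => G _.
by rewrite /wt -big_split; apply: eq_bigr => e _; case: ifP.
Qed.

Lemma Ex_cst a (k : R) : Ex a (fun=> k) = k.
Proof.
rewrite /Ex -big_distrl /=.
suff -> : \sum_G wt a G = 1 by rewrite mul1r.
have := Ex_prod a (fun=> 1) (fun=> 1); rewrite /Ex.
move=> E; rewrite -[RHS](_ : \prod_(e : T) (a e * 1 + (1 - a e) * 1) = 1).
  rewrite -E; apply: eq_bigr => G _; rewrite [X in _ * X]big1 ?mulr1 // => i _.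
  by case: ifP.
by apply: big1 => e _; ring.
Qed.

Lemma ExD a F F' : Ex a (fun G => F G + F' G) = Ex a F + Ex a F'.
Proof. by rewrite /Ex -big_split; apply: eq_bigr => G _; rewrite mulrDr. Qed.

Lemma ExZ a k F : Ex a (fun G => k * F G) = k * Ex a F.
Proof. by rewrite /Ex big_distrr; apply: eq_bigr => G _; rewrite mulrCA. Qed.

Lemma Ex_sum a (I : finType) (F : I -> {set T} -> R) :
  Ex a (fun G => \sum_i F i G) = \sum_i Ex a (F i).
Proof.
by rewrite /Ex exchange_big; apply: eq_bigr => G _; rewrite big_distrr.
Qed.

Lemma wt_ge0 a G : (forall e, 0 <= a e <= 1) -> 0 <= wt a G.
Proof.
move=> a01; apply: prodr_ge0 => e _; have /andP[a0 a1] := a01 e.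
by case: ifP => // _; rewrite subr_ge0.
Qed.

Lemma le_Ex a F F' : (forall e, 0 <= a e <= 1) ->
  (forall G, F G <= F' G) -> Ex a F <= Ex a F'.
Proof.
by move=> a01 FF'; apply: ler_sum => G _; apply: ler_wpM2l; rewrite ?wt_ge0.
Qed.

Lemma Ex_ge0 a F : (forall e, 0 <= a e <= 1) -> (forall G, 0 <= F G) ->
  0 <= Ex a F.
Proof. by move=> a01 F0; apply: sumr_ge0 => G _; rewrite mulr_ge0 ?wt_ge0. Qed.

Lemma Ex_cond a F e :
  Ex a F = a e * Ex (upd a e 1) F + (1 - a e) * Ex (upd a e 0) F.
Proof.
rewrite /Ex !big_distrr -big_split; apply: eq_bigr => G _ /=.
rewrite !mulrA -mulrDl; congr (_ * _).
have rest v : \prod_(i | i != e) (if i \in G then upd a e v i else 1 - upd a e v i) =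
    \prod_(i | i != e) (if i \in G then a i else 1 - a i).
  by apply: eq_bigr => i /negbTE ie; rewrite /upd ie.
have wtD b : wt b G = (if e \in G then b e else 1 - b e) *
    \prod_(i | i != e) (if i \in G then b i else 1 - b i).
  by rewrite /wt (bigD1 e).
rewrite !wtD !rest /upd eqxx.
by case: ifP => _; ring.
Qed.

Lemma upd_id a e v : a e = v -> upd a e v = a.
Proof. by move=> av; apply/funext => i; rewrite /upd; case: eqP => // ->. Qed.

Lemma Ex_upd1 a F F' e : (forall G : {set T}, e \in G -> F G = F' G) ->
  Ex (upd a e 1) F = Ex (upd a e 1) F'.
Proof.
move=> FF'; apply: eq_bigr => G _; have [eG|eG] := boolP (e \in G).
  by rewrite FF'.
by rewrite /wt (bigD1 e) //= (negbTE eG) /upd eqxx subrr !mul0r.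
Qed.

Lemma Ex_upd0 a F F' e : (forall G : {set T}, e \notin G -> F G = F' G) ->
  Ex (upd a e 0) F = Ex (upd a e 0) F'.
Proof.
move=> FF'; apply: eq_bigr => G _; have [eG|eG] := boolP (e \in G).
  by rewrite /wt (bigD1 e) //= eG /upd eqxx !mul0r.
by rewrite FF'.
Qed.

(** [expR u * (1 - u) <= 1], while [(1 - u) * (1 + u + 2 * u ^+ 2) = 1 + u ^+ 2 * (1 - 2 * u)] is at
    least 1. *)
Lemma expR_le_quad (u : R) : u <= 1 / 2 -> expR u <= 1 + u + 2 * u ^+ 2.
Proof.
move=> u2; have h := expR_ge1Dx (- u).
have e0 := expR_gt0 u.
have : expR u * expR (- u) = 1 by rewrite -expRD subrr expR0.
nra.
Qed.

Definition dev a (c : T -> R) (G : {set T}) : R :=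
  \sum_e c e * ((e \in G)%:R - a e).

(** By independence the moment generating function is a product. In each factor the linear terms
    cancel, leaving at most [1 + t ^+ 2 / 2] since [a e * (1 - a e) <= 1 / 4]. *)
Lemma Ex_expR_dev a c t : (forall e, 0 <= a e <= 1) ->
  (forall e, `|c e| <= 1) -> `|t| <= 1 / 2 ->
  Ex a (fun G => expR (t * dev a c G)) <= expR (t ^+ 2 / 2 * #|T|%:R).
Proof.
move=> a01 c1 t2.
have -> : Ex a (fun G => expR (t * dev a c G)) =
    \prod_e (a e * expR (t * (c e * (1 - a e))) +
             (1 - a e) * expR (t * (c e * (0 - a e)))).
  rewrite -Ex_prod; apply: eq_bigr => G _; congr (_ * _).
  rewrite /dev big_distrr /= expR_sum; apply: eq_bigr => e _.
  by case: ifP.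
rewrite expRM_natr -prodr_const; apply: ler_prod => e _.
have /andP[a0 a1] := a01 e; have := c1 e; move: t2; rewrite !ler_norml.
move=> /andP[t_ge t_le] /andP[c_ge c_le]; apply/andP; split.
  by rewrite addr_ge0 // mulr_ge0 ?expR_ge0 // subr_ge0.
have [p q] : t * c e <= 1 / 2 /\ - (t * c e) <= 1 / 2 by split; nra.
have c2 : c e ^+ 2 <= 1 by nra.
set r := t * c e in p q.
have -> : t * (c e * (1 - a e)) = r * (1 - a e) by rewrite /r; ring.
have -> : t * (c e * (0 - a e)) = - (r * a e) by rewrite /r; ring.
have h1 : expR (r * (1 - a e)) <= 1 + r * (1 - a e) + 2 * (r * (1 - a e)) ^+ 2.
  by apply: expR_le_quad; nra.
have h2 : expR (- (r * a e)) <= 1 - r * a e + 2 * (- (r * a e)) ^+ 2.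
  by apply: expR_le_quad; nra.
apply: le_trans (expR_ge1Dx _).
have h1' := ler_wpM2l a0 h1.
have h2' : (1 - a e) * expR (- (r * a e)) <=
    (1 - a e) * (1 - r * a e + 2 * (- (r * a e)) ^+ 2).
  by apply: ler_wpM2l h2; rewrite subr_ge0.
apply: le_trans (lerD h1' h2') _.
have -> : a e * (1 + r * (1 - a e) + 2 * (r * (1 - a e)) ^+ 2) +
    (1 - a e) * (1 - r * a e + 2 * (- (r * a e)) ^+ 2) =
    1 + 2 * r ^+ 2 * (a e * (1 - a e)) by ring.
have r2 : 0 <= r ^+ 2 by apply: sqr_ge0.
have r2t : r ^+ 2 <= t ^+ 2.
  by rewrite /r exprMn; have := sqr_ge0 t; nra.
have : a e * (1 - a e) <= 1 / 4 by have := sqr_ge0 (a e - 1 / 2); nra.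
have : 0 <= a e * (1 - a e) by nra.
nra.
Qed.

Lemma Ex_dev_tail a c (s t : R) : (forall e, 0 <= a e <= 1) ->
  (forall e, `|c e| <= 1) -> 0 <= t <= 1 / 2 ->
  Ex a (fun G => (s <= `|dev a c G|)%R%:R) <=
  2 * expR (t ^+ 2 / 2 * #|T|%:R - t * s).
Proof.
move=> a01 c1 /andP[t0 t2].
(* Markov's inequality pointwise: the two exponentials together dominate the indicator of either
   tail. *)
have step G : (s <= `|dev a c G|)%R%:R <=
    expR (- (t * s)) * (expR (t * dev a c G) + expR (- t * dev a c G)).
  case: (boolP (s <= _)) => [h|_]; last by rewrite mulr_ge0 ?addr_ge0 ?expR_ge0.
  rewrite mulrDr -!expRD.
  have e1 := expR_ge0 (- (t * s) + t * dev a c G).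
  have e2 := expR_ge0 (- (t * s) + - t * dev a c G).
  case: (lerP 0 (dev a c G)) h => [d0|d0].
    rewrite ger0_norm // => sd.
    have := ler_wpM2l t0 sd; have := expR_ge1Dx (- (t * s) + t * dev a c G).
    by rewrite mulr1n; lra.
  rewrite ltr0_norm // => sd.
  have := ler_wpM2l t0 sd; have := expR_ge1Dx (- (t * s) + - t * dev a c G).
  by rewrite mulr1n; lra.
apply: le_trans (le_Ex a01 step) _.
rewrite ExZ ExD [in leRHS]addrC expRD mulrCA; apply: ler_wpM2l; first exact: expR_ge0.
rewrite mulr_natl mulr2n; apply: lerD.
  by apply: Ex_expR_dev => //; rewrite ger0_norm.
by rewrite -(sqrrN t); apply: Ex_expR_dev => //; rewrite normrN ger0_norm.
Qed.

End ProductMeasure.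

(** * Decision trees *)

Section Trees.
Variables (R : realType) (n : nat).
Implicit Types (a b : vpair n -> R) (t : dtree n).

(** Compatibility with the answers that [a] has already fixed; requiring the query bound only here
    lets it decrease along a branch. *)
Definition consistent a (G : sgraph n) : Prop :=
  forall e, (a e = 1 -> e \in G) /\ (a e = 0 -> e \notin G).

(** The inequality bounds by [D] the chi-squared divergence of a Bernoulli variable of parameter
    [b e] from a fair one. *)
Definition revealed_or_fresh a b (D : R) (e : vpair n) : Prop :=
  (a e = b e /\ (a e = 0 \/ a e = 1)) \/
  (a e = 1 / 2 /\ b e ^+ 2 + (1 - b e) ^+ 2 <= (1 + D) / 2).

Lemma revealed_upd a b D (e : vpair n) (v : R) : v = 0 \/ v = 1 ->
  (forall i, revealed_or_fresh a b D i) ->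
  forall i, revealed_or_fresh (upd a e v) (upd b e v) D i.
Proof.
move=> v01 ab i; have := ab i; rewrite /revealed_or_fresh /upd.
by case: eqP => // _ _; left.
Qed.

Lemma chi2_step (D p K x x' y y' : R) : 0 <= D ->
  p ^+ 2 + (1 - p) ^+ 2 <= (1 + D) / 2 -> x ^+ 2 <= K * x' -> y ^+ 2 <= K * y' ->
  (p * x + (1 - p) * y) ^+ 2 <= (1 + D) * K * (1 / 2 * x' + (1 - 1 / 2) * y').
Proof.
move=> D0 pD hx hy.
have cs : (p * x + (1 - p) * y) ^+ 2 <=
    (p ^+ 2 + (1 - p) ^+ 2) * (x ^+ 2 + y ^+ 2).
  by have := sqr_ge0 (p * y - (1 - p) * x); nra.
apply: le_trans cs _.
have xy : 0 <= x ^+ 2 + y ^+ 2 by rewrite addr_ge0 ?sqr_ge0.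
apply: le_trans (ler_wpM2r xy pD) _.
have -> : (1 + D) * K * (1 / 2 * x' + (1 - 1 / 2) * y') =
    (1 + D) / 2 * (K * x' + K * y') by field.
by apply: ler_wpM2l; [lra | apply: lerD].
Qed.

(* Conditioning on a fresh answer keeps both measures in product form, and
   Cauchy-Schwarz costs a factor 1 + D; an already revealed pair costs nothing.
   Hence only the number of queries matters, also for trees which repeat them. *)
Lemma tree_change_of_measure t (good : pred (vcut n)) (D : R) a b (q : nat) :
  0 <= D -> (forall e, revealed_or_fresh a b D e) ->
  (forall G, consistent a G -> (queries t G <= q)%N) ->
  Ex b (fun G => (good (output t G))%:R) ^+ 2 <=
  (1 + D) ^+ q * Ex a (fun G => (good (output t G))%:R).
Proof.
move=> D0; elim: t a b q => [P|e t0 IH0 t1 IH1] a b q ab tq /=.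
  rewrite !Ex_cst; have : 1 <= (1 + D) ^+ q by rewrite exprn_ege1 // lerDl.
  by case: (good P); rewrite /= ?expr0n ?mulr0 ?expr1n ?mulr1.
pose F t G : R := (good (output t G))%:R.
have F1 (G : sgraph n) : e \in G ->
    (good (if e \in G then output t1 G else output t0 G))%:R = F t1 G.
  by move=> ->.
have F0 (G : sgraph n) : e \notin G ->
    (good (if e \in G then output t1 G else output t0 G))%:R = F t0 G.
  by move=> /negbTE ->.
(* A revealed pair has the same certain answer under both measures, so the tree reduces to one
   branch. *)
case: (ab e) => [[abe [a0|a1]]|[ae be]].
- have b0 : b e = 0 by rewrite -abe.
  rewrite -(upd_id a0) -(upd_id b0) (Ex_upd0 _ F0) (Ex_upd0 _ F0).
  rewrite (upd_id a0) (upd_id b0); apply: IH0 => // G Gc.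
  by have := tq G Gc; rewrite /= (negbTE (proj2 (Gc e) a0)) => /ltnW.
- have b1 : b e = 1 by rewrite -abe.
  rewrite -(upd_id a1) -(upd_id b1) (Ex_upd1 _ F1) (Ex_upd1 _ F1).
  rewrite (upd_id a1) (upd_id b1); apply: IH1 => // G Gc.
  by have := tq G Gc; rewrite /= (proj1 (Gc e) a1) => /ltnW.
(* Budget 0 is impossible: the graph of the pairs of probability 1 is consistent, and the tree
   queries on it. *)
case: q tq => [|q] tq.
  have /tq : consistent a [set i | a i == 1].
    by move=> i; rewrite inE; split=> ->; rewrite ?eqxx // eq_sym oner_eq0.
  by [].
rewrite (Ex_cond b _ e) (Ex_cond a _ e).
rewrite (Ex_upd0 b F0) (Ex_upd0 a F0) (Ex_upd1 b F1) (Ex_upd1 a F1).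
(* Since [a e = 1 / 2], consistency with [a] asks nothing at [e]. *)
have consistent_upd v G : consistent (upd a e v) G -> consistent a G.
  move=> Gc i; case: (eqVneq i e) => [->|ie]; first by rewrite ae; split; lra.
  by have := Gc i; rewrite /upd (negbTE ie).
have h1 : Ex (upd b e 1) (F t1) ^+ 2 <= (1 + D) ^+ q * Ex (upd a e 1) (F t1).
  apply: IH1 => [|G Gc]; first by apply: revealed_upd => //; right.
  have := tq G (consistent_upd _ _ Gc); rewrite /=.
  by have [->] := Gc e; last by rewrite /upd eqxx.
have h0 : Ex (upd b e 0) (F t0) ^+ 2 <= (1 + D) ^+ q * Ex (upd a e 0) (F t0).
  apply: IH0 => [|G Gc]; first by apply: revealed_upd => //; left.
  have := tq G (consistent_upd _ _ Gc); rewrite /=.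
  by have [_] := Gc e; rewrite {1}/upd eqxx => /(_ erefl)/negbTE ->.
by rewrite ae [(1 + D) ^+ _]exprS; apply: chi2_step.
Qed.

End Trees.

(** * Cuts as sign vectors *)

Section Signs.
Variables (R : realType) (n : nat).
Implicit Types (x y P : vcut n) (G : sgraph n).

Definition sg (b : bool) : R := if b then 1 else -1.

Definition sgsum P : R := \sum_v sg (P v).

Definition corr x y : R := \sum_v sg (x v) * sg (y v).

Lemma crosses_pair P u v : crosses P [set u; v] = (P u != P v).
Proof.
have half b : ([set u; v] :&: [set w | P w == b] != finset.set0) =
    (P u == b) || (P v == b).
  apply/set0Pn/orP => [[w]|[h|h]].
  - by rewrite !inE => /andP[/orP[]/eqP-> h]; [left | right].
  - by exists u; rewrite !inE eqxx.
  - by exists v; rewrite !inE eqxx orbT.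
by rewrite /crosses !half; case: (P u); case: (P v).
Qed.

(** Each two-element set arises from exactly two ordered pairs. *)
Lemma sum_vpair (f : {set 'I_n} -> R) :
  (\sum_(e : vpair n) f (val e)) *+ 2 =
  \sum_u \sum_(v | u != v) f [set u; v].
Proof.
rewrite pair_big_dep /=.
rewrite (partition_big (fun p : 'I_n * 'I_n => [set p.1; p.2]%SET)
  (fun A : {set 'I_n} => #|A| == 2)) /=; last first.
  by move=> [u v] /= uv; rewrite cards2 uv.
rewrite -sumrMnl [RHS](eq_bigr (fun A => f A *+ 2)); last first.
  move=> A /cards2P[i [j [ij ->]]].
  rewrite (eq_bigr (fun=> f [set i; j])); last by move=> p /andP[_ /eqP->].
  rewrite sumr_const; congr (_ *+ _).
  have -> : 2%N = #|[set (i, j); (j, i)]|.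
    by rewrite cards2 xpair_eqE negb_and ij.
  apply: eq_card => -[u v]; rewrite !inE /= !xpair_eqE.
  apply/andP/orP => [[uv /eqP E]|[/andP[/eqP-> /eqP->]|/andP[/eqP-> /eqP->]]].
  - have := set21 u v; have := set22 u v; rewrite E !inE.
    move=> /orP[]/eqP vE /orP[]/eqP uE; rewrite vE uE ?eqxx; auto;
    by rewrite vE uE eqxx in uv.
  - by [].
  - by rewrite eq_sym ij finset.setUC.
rewrite [RHS](reindex_omap (val : vpair n -> {set 'I_n}) insub) /=.
  by apply: eq_bigl => -[A hA] /=; rewrite hA insubT eqxx.
by move=> A hA; rewrite insubT.
Qed.

(** In signs, a pair u, v contributes (1 - P_u P_v) / 2 times - x_u x_v. This vanishes on the
    diagonal, so the full double sum splits into two squares. *)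
Lemma sum_cross_sg x P :
  \sum_(e : vpair n) (crosses P (val e))%:R * sg (crosses x (val e)) =
  (corr x P ^+ 2 - sgsum x ^+ 2) / 4.
Proof.
pose f A : R := (crosses P A)%:R * sg (crosses x A).
suff E : (\sum_(e : vpair n) f (val e)) *+ 2 =
    (corr x P ^+ 2 - sgsum x ^+ 2) / 2.
  by rewrite -/(f _) -[LHS](mulfK (_ : 2 != 0)) // mulr_natr E; field.
rewrite sum_vpair !expr2 /corr /sgsum !big_distrl /= -sumrB big_distrl /=.
apply: eq_bigr => u _.
rewrite !big_distrr /= -sumrB big_distrl /= [LHS]big_mkcond /=.
apply: eq_bigr => v _; rewrite /f !crosses_pair; case: eqVneq => [->|_] /=.
  by rewrite /sg; case: (x v); case: (P v) => /=; ring.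
by rewrite /sg; case: (x u); case: (x v); case: (P u); case: (P v) => /=; field.
Qed.

Lemma sum_cross P :
  \sum_(e : vpair n) (crosses P (val e))%:R = (n%:R ^+ 2 - sgsum P ^+ 2) / 4 :> R.
Proof.
pose f A : R := (crosses P A)%:R.
suff E : (\sum_(e : vpair n) f (val e)) *+ 2 =
    (n%:R ^+ 2 - sgsum P ^+ 2) / 2.
  by rewrite -/(f _) -[LHS](mulfK (_ : 2 != 0)) // mulr_natr E; field.
have -> : n%:R = \sum_(u < n) 1 :> R by rewrite sumr_const card_ord.
rewrite sum_vpair !expr2 /sgsum !big_distrl /= -sumrB big_distrl /=.
apply: eq_bigr => u _.
rewrite !big_distrr /= -sumrB big_distrl /= [LHS]big_mkcond /=.
apply: eq_bigr => v _; rewrite /f !crosses_pair; case: eqVneq => [->|_] /=.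
  by rewrite /sg; case: (P v) => /=; ring.
by rewrite /sg; case: (P u); case: (P v) => /=; field.
Qed.

Lemma corr_self x : corr x x = n%:R.
Proof.
rewrite /corr (eq_bigr (fun=> 1)) ?sumr_const ?card_ord // => v _.
by rewrite /sg; case: (x v); ring.
Qed.

Lemma sgsumE P : sgsum P = #|V1 P|%:R *+ 2 - n%:R.
Proof.
have -> : #|V1 P|%:R = \sum_v (P v)%:R :> R.
  rewrite -sum1_card natr_sum big_mkcond; apply: eq_bigr => v _.
  by rewrite inE; case: (P v).
have -> : n%:R = \sum_(u < n) 1 :> R by rewrite sumr_const card_ord.
rewrite -sumrMnl -sumrB; apply: eq_bigr => v _.
by rewrite /sg; case: (P v) => /=; ring.
Qed.

Lemma cut_sizeE G P :
  (cut_size G P)%:R = \sum_e (crosses P (val e))%:R * (e \in G)%:R :> R.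
Proof.
rewrite /cut_size -sum1_card natr_sum big_mkcond; apply: eq_bigr => e _.
by rewrite inE; case: (e \in G); case: (crosses P _) => /=; rewrite ?mulr0 ?mulr1.
Qed.

(* The sign s is 1 for the planted maximum cut, -1 for the planted minimum
   bisection. *)
Definition planted (s d : R) x (e : vpair n) : R :=
  1 / 2 + s * d * sg (crosses x (val e)).

(** The size of [P] minus its mean under the planted measure. *)
Definition cut_dev s d x P G : R :=
  dev (planted s d x) (fun e => (crosses P (val e))%:R) G.

Lemma cut_size_planted s d x P G :
  (cut_size G P)%:R = cut_dev s d x P G + (n%:R ^+ 2 - sgsum P ^+ 2) / 8 +
    s * d * ((corr x P ^+ 2 - sgsum x ^+ 2) / 4).
Proof.
have -> : (n%:R ^+ 2 - sgsum P ^+ 2) / 8 =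
    (n%:R ^+ 2 - sgsum P ^+ 2) / 4 * (1 / 2) :> R by field.
rewrite -sum_cross -sum_cross_sg cut_sizeE /cut_dev /dev big_distrl big_distrr /=.
rewrite -!big_split /=; apply: eq_bigr => e _; rewrite /planted; ring.
Qed.

Lemma card_vpair_le : #|{: vpair n}|%:R <= n%:R ^+ 2 / 2 :> R.
Proof.
rewrite card_sig.
have -> : #|[pred e : {set 'I_n} | #|e| == 2]| = 'C(n, 2).
  by rewrite -[n in RHS]card_ord -card_draws; apply: eq_card => A; rewrite !inE.
rewrite ler_pdivlMr // -natrX -natrM ler_nat bin2 muln2.
apply: (@leq_trans (n * n.-1)); last by rewrite -mulnn leq_mul2l leq_pred orbT.
by rewrite -[leqRHS]odd_double_half leq_addl.
Qed.

End Signs.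

(** * The planted distribution *)

Section Planted.
Variables (R : realType) (n : nat).
Implicit Types (x y P : vcut n) (G : sgraph n) (s d eps : R).

Lemma planted01 s d x e : `|s| = 1 -> 0 <= d <= 1 / 2 ->
  0 <= planted s d x e <= 1.
Proof.
move=> s1 /andP[d0 d2]; rewrite /planted.
have : `|s * d * sg R (crosses x (val e))| <= 1 / 2.
  rewrite !normrM s1 (ger0_norm d0) /sg.
  by case: ifP => _; rewrite ?normrN normr1; lra.
by rewrite ler_norml => /andP[]; lra.
Qed.

Definition fair : vpair n -> R := fun=> 1 / 2.

(** Equality holds: p = 1/2 + d or 1/2 - d gives p^2 + (1 - p)^2 = 1/2 + 2 d^2. *)
Lemma planted_fresh s d x e : `|s| = 1 ->
  revealed_or_fresh fair (planted s d x) (4 * d ^+ 2) e.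
Proof.
move=> s1; right; split=> //; rewrite /planted.
have s2 : s ^+ 2 = 1 by rewrite -real_normK ?num_real // s1 expr1n.
have c2 : sg R (crosses x (val e)) ^+ 2 = 1 by rewrite /sg; case: ifP => _; ring.
set c := sg R _ in c2 *; rewrite le_eqVlt; apply/orP; left; apply/eqP.
have -> : (1 / 2 + s * d * c) ^+ 2 + (1 - (1 / 2 + s * d * c)) ^+ 2 =
  1 / 2 + 2 * d ^+ 2 * s ^+ 2 * c ^+ 2 by field.
by rewrite s2 c2; field.
Qed.

Lemma cut_dev_tail s d x P (eta : R) : `|s| = 1 -> 0 <= d <= 1 / 2 ->
  0 <= eta <= 1 / 4 ->
  Ex (planted s d x) (fun G => (eta * n%:R ^+ 2 <= `|cut_dev s d x P G|)%R%:R) <=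
  2 * expR (- (eta ^+ 2 * n%:R ^+ 2)).
Proof.
move=> s1 d2 /andP[e0 e1].
(* With at most n^2 / 2 pairs, [2 * eta] is the optimal exponent parameter; [eta <= 1 / 4] keeps it
   below 1/2. *)
have h := @Ex_dev_tail R _ (planted s d x) (fun e => (crosses P (val e))%:R)
  (eta * n%:R ^+ 2) (2 * eta).
apply: le_trans (h _ _ _) _.
- by move=> e; apply: planted01.
- by move=> e; case: crosses; rewrite ?normr0 ?normr1 ?ler01.
- by apply/andP; split; lra.
rewrite ler_pM2l // ler_expR.
have := card_vpair_le R n; have := sqr_ge0 eta; nra.
Qed.

(** Union bound: each tail is at most 2 exp(-2n), and there are 2^n <= exp(n) cuts. *)
Lemma all_cut_dev_tail s d x (eta : R) : `|s| = 1 -> 0 <= d <= 1 / 2 ->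
  0 <= eta <= 1 / 4 -> 2 <= eta ^+ 2 * n%:R ->
  Ex (planted s d x)
    (fun G => [exists P, (eta * n%:R ^+ 2 <= `|cut_dev s d x P G|)%R]%:R) <=
  2 * expR (- n%:R).
Proof.
move=> s1 d2 e4 en.
apply: (@le_trans _ _ (\sum_(P : vcut n) 2 * expR (- (eta ^+ 2 * n%:R ^+ 2)))).
  apply: (@le_trans _ _ (\sum_P Ex (planted s d x)
      (fun G => (eta * n%:R ^+ 2 <= `|cut_dev s d x P G|)%R%:R))).
    rewrite -Ex_sum; apply: le_Ex => [e|G]; first exact: planted01.
    case: existsP => [[P hP]|_]; last by apply: sumr_ge0.
    by rewrite (bigD1 P) //= hP lerDl sumr_ge0.
  by apply: ler_sum => P _; apply: cut_dev_tail.
rewrite sumr_const card_ffun card_bool card_ord -mulrnAr ler_pM2l //.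
rewrite -mulr_natr natrX.
have le2 : (2 : R) ^+ n <= expR n%:R.
  rewrite -[n%:R]mul1r expRM_natr; apply: lerXn2r; rewrite ?nnegrE ?expR_ge0 //.
  by apply: le_trans (expR_ge1Dx _); lra.
apply: (@le_trans _ _ (expR (- (2 * n%:R)) * expR n%:R)).
  apply: ler_pM; rewrite ?expR_ge0 ?exprn_ge0 // ler_expR lerN2.
  by rewrite expr2 mulrA ler_wpM2r.
by rewrite -expRD ler_expR; lra.
Qed.

(** For uniform [x], half of [corr R x y] is a deviation of the random set [V1 x]. The event forces
    |corr| >= 7n/10, as 49/100 <= 1/2, and the parameter 1/3 gives exponent n/18 - 7n/60 <= -
    n/18. *)
Lemma corr_tail y :
  \sum_(x : vcut n) (n%:R ^+ 2 / 2 <= corr R x y ^+ 2)%R%:R <=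
  2 ^+ n * (2 * expR (- (n%:R / 18))) :> R.
Proof.
pose h : 'I_n -> R := fun=> 1 / 2.
pose c v := sg R (y v).
pose F (A : {set 'I_n}) : R := (7 / 20 * n%:R <= `|dev h c A|)%R%:R.
have h01 v : 0 <= h v <= 1 by rewrite /h; lra.
have c1 v : `|c v| <= 1 by rewrite /c /sg; case: ifP => _; rewrite ?normrN normr1.
have t3 : 0 <= (1 / 3 : R) <= 1 / 2 by lra.
have wtE A : wt h A = 2 ^- n.
  rewrite /wt (eq_bigr (fun=> 2^-1)) ?prodr_const ?card_ord ?exprVn // => v _.
  by rewrite /h; case: ifP => _; field.
apply: (@le_trans _ _ (2 ^+ n * Ex h F)); last first.
  apply: ler_wpM2l; first exact: exprn_ge0.
  apply: le_trans (Ex_dev_tail (7 / 20 * n%:R) h01 c1 t3) _.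
  by rewrite ler_pM2l // ler_expR card_ord; have := ler0n R n; nra.
have -> : 2 ^+ n * Ex h F = \sum_A F A.
  rewrite big_distrr; apply: eq_bigr => A _ /=.
  by rewrite wtE mulrA mulfV ?mul1r // expf_neq0.
rewrite [leRHS](reindex (fun x : vcut n => V1 x)) /=; last first.
  exists (fun A : {set 'I_n} => [ffun v => v \in A]) => [x|A] _.
    by apply/ffunP => v; rewrite ffunE inE; case: (x v).
  by apply/setP => v; rewrite inE ffunE; case: (v \in A).
apply: ler_sum => x _.
have E : dev h c (V1 x) = corr R x y / 2.
  rewrite /dev /corr big_distrl; apply: eq_bigr => v _ /=.
  by rewrite inE /h /c /sg; case: (x v); case: (y v) => /=; field.
rewrite ler_nat /F E; case: (boolP (_ <= corr R x y ^+ 2)) => //= hc.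
rewrite lt0b normrM [`|2^-1|]ger0_norm ?invr_ge0 //.
have n0 := ler0n R n.
suff : 7 / 10 * n%:R <= `|corr R x y| by lra.
rewrite -(@ler_pXn2r _ 2) ?nnegrE ?mulr_ge0 //.
rewrite real_normK ?num_real //; have := sqr_ge0 (n%:R : R); nra.
Qed.

(** Rounding down covers odd n as well; for even n these are the bisections. *)
Definition balanced : {set vcut n} := [set x : vcut n | #|V1 x| == n./2].

(** The central binomial coefficient is the largest of the n + 1 coefficients summing to 2^n. *)
Lemma card_balanced : (2 ^ n <= n.+1 * #|balanced|)%N.
Proof.
have -> : #|balanced| = 'C(n, n./2).
  have -> : 'C(n, n./2) = 'C(#|'I_n|, n./2) by rewrite card_ord.
  rewrite -card_draws -(card_imset (mem balanced) (f := @V1 n)); last first.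
    move=> x x' /setP E; apply/ffunP => v; have := E v.
    by rewrite !inE; case: (x v); case: (x' v).
  apply: eq_card => A; rewrite inE; apply/imsetP/idP => [[x]|hA].
    by rewrite inE => ? ->.
  exists [ffun v => v \in A].
    rewrite inE -(eqP hA); apply/eqP/eq_card => v.
    by rewrite inE ffunE; case: (v \in A).
  by apply/setP => v; rewrite inE ffunE; case: (v \in A).
have up k : (k.*2 < n -> 'C(n, k) <= 'C(n, k.+1))%N.
  move=> kn; have := mul_bin_left n k => E.
  rewrite -(leq_pmul2l (ltn0Sn k)) E leq_mul2r; apply/orP; right.
  by rewrite ltn_subRL addnn.
have low k : (k <= n./2 -> 'C(n, k) <= 'C(n, n./2))%N.
  move=> kn; rewrite -(subKn kn); elim: (n./2 - k)%N => [|i IH]; rewrite ?subn0 //.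
  apply: leq_trans IH; case: (ltnP i n./2) => ik; last first.
    by rewrite (eqP (ik : n./2 - i == 0)%N) subnS (eqP (ik : n./2 - i == 0)%N).
  rewrite subnS -[X in (_ <= 'C(_, X))%N](prednK _) ?subn_gt0 //; apply: up.
  rewrite -subnS -[X in (_ < X)%N]odd_double_half.
  apply: leq_trans (leq_addl _ _); rewrite ltn_double.
  by rewrite ltn_subrL (leq_trans _ ik).
have mid k : ('C(n, k) <= 'C(n, n./2))%N.
  case: (leqP k n./2) => [/low //|nk]; case: (leqP k n) => [kn|/bin_small-> //].
  rewrite -bin_sub //; apply: low.
  rewrite leq_subLR -{1}[n]odd_double_half -addnn.
  by rewrite addnA leq_add2r (leq_trans _ nk) // -add1n leq_add2r leq_b1.
have -> : (2 ^ n = \sum_(i < n.+1) 'C(n, i))%N.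
  rewrite -[2%N]/(1 + 1)%N expnDn; apply: eq_bigr => i _.
  by rewrite !exp1n !muln1.
apply: (@leq_trans (\sum_(i < n.+1) 'C(n, n./2))%N); last first.
  by rewrite sum_nat_const card_ord.
by apply: leq_sum => i _; apply: mid.
Qed.

End Planted.

(** * The lower bound for deterministic trees *)

Section Deterministic.
Variables (R : realType) (n : nat) (s eps : R).
Implicit Types (x y P : vcut n) (G : sgraph n).

(** Common consequence of both notions of near-optimality: [P] competes with the planted [x] instead
    of the optimum. The second clause bounds what [P] can gain in the mean through its imbalance. *)
Definition success x G P : bool :=
  (s * (cut_size G x)%:R - eps * n%:R ^+ 2 <= s * (cut_size G P)%:R) &&
  (s * (sgsum R x ^+ 2 - sgsum R P ^+ 2) <= 1).

(** After multiplying by [s], the mean of [P] trails that of [x] by 8 eps (n^2 - <x, P>^2), up to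
    1/8. If <x, P>^2 < n^2 / 2 this loss exceeds 4 eps n^2, but tolerance and deviations allow less
    than 2 eps n^2, and eps n^2 >= 8 absorbs the 1/8. *)
Lemma success_corr x G P :
  `|s| = 1 -> 0 < eps < 1 / 1000 -> 8 <= eps ^+ 2 * n%:R ->
  (forall P', `|cut_dev s (32 * eps) x P' G| < eps / 2 * n%:R ^+ 2) ->
  success x G P -> n%:R ^+ 2 / 2 <= corr R x P ^+ 2.
Proof.
move=> s1 /andP[eps_gt0 eps_lt] eps_n.
have eps_le1 : eps <= 1 by lra.
move=> small /andP[]; rewrite !(cut_size_planted s (32 * eps) x) corr_self.
have s2 : s ^+ 2 = 1 by rewrite -real_normK ?num_real // s1 expr1n.
have bound P' : s * cut_dev s (32 * eps) x P' G < eps / 2 * n%:R ^+ 2 /\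
    - (eps / 2 * n%:R ^+ 2) < s * cut_dev s (32 * eps) x P' G.
  have : `|s * cut_dev s (32 * eps) x P' G| < eps / 2 * n%:R ^+ 2.
    by rewrite normrM s1 mul1r.
  by rewrite ltr_norml => /andP[].
have [_ bx] := bound x; have [bP _] := bound P.
move: (cut_dev _ _ x x G) (cut_dev _ _ x P G) bx bP => u v bx bP.
move: (sgsum R x ^+ 2) (sgsum R P ^+ 2) (corr R x P ^+ 2) => X Y C h1 h2.
rewrite leNgt; apply/negP => Cn.
have Ex_x : s * (u + (n%:R ^+ 2 - X) / 8 + s * (32 * eps) * ((n%:R ^+ 2 - X) / 4)) =
    s * u + s * (n%:R ^+ 2 - X) / 8 + 8 * eps * (s ^+ 2 * (n%:R ^+ 2 - X)).
  by field.
have Ex_P : s * (v + (n%:R ^+ 2 - Y) / 8 + s * (32 * eps) * ((C - X) / 4)) =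
    s * v + s * (n%:R ^+ 2 - Y) / 8 + 8 * eps * (s ^+ 2 * (C - X)).
  by field.
move: h1; rewrite Ex_x Ex_P s2 !mul1r => h1.
have eN : 8 <= eps * n%:R.
  apply: le_trans eps_n _; rewrite expr2 -mulrA.
  by apply: ler_piMl; [rewrite mulr_ge0 // ltW | ].
have n1 : 1 <= n%:R :> R by have := ler_wpM2r (ler0n R n) (ltW eps_lt); lra.
have : 8 <= eps * n%:R ^+ 2.
  by apply: (le_trans eN); rewrite expr2 mulrA; apply: ler_peMr => //; lra.
have : 8 * eps * C < 8 * eps * (n%:R ^+ 2 / 2) by rewrite ltr_pM2l //; lra.
move: h1 h2 bx bP; move: (n%:R ^+ 2 : R) => N.
lra.
Qed.

Lemma tree_success_le (c : R) (t : dtree n) :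
  0 <= c -> 64 * 64 * c <= 1 / 36 ->
  `|s| = 1 -> 0 < eps < 1 / 1000 -> 8 <= eps ^+ 2 * n%:R ->
  (forall G, (queries t G)%:R <= c * (n%:R / eps ^+ 2)) ->
  2 * expR (- n%:R) <= 1 / 400 :> R ->
  n.+1%:R * (2 * expR (- (n%:R / 36))) <= 1 / 400 / 400 :> R ->
  \sum_(x in balanced n)
     Ex (planted s (32 * eps) x) (fun G => (success x G (output t G))%:R) <=
  #|balanced n|%:R / 200.
Proof.
move=> c0 c_le s1 eps01 eps_n tq n_a n_b; have /andP[eps_gt0 eps_lt] := eps01.
set d := 32 * eps; have d01 : 0 <= d <= 1 / 2 by rewrite /d; lra.
pose good x := [pred y | n%:R ^+ 2 / 2 <= corr R x y ^+ 2].
pose m x := Ex (planted s d x) (fun G => (good x (output t G))%:R).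
pose bad x G := [exists P, (eps / 2 * n%:R ^+ 2 <= `|cut_dev s d x P G|)%R].
have bad_le x : Ex (planted s d x) (fun G => (bad x G)%:R) <= 1 / 400.
  apply: le_trans n_a; apply: all_cut_dev_tail => //; first by lra.
  have -> : (eps / 2) ^+ 2 * n%:R = (eps ^+ 2 * n%:R) / 4 by field.
  by lra.
have split_success x :
    Ex (planted s d x) (fun G => (success x G (output t G))%:R) <=
    Ex (planted s d x) (fun G => (bad x G)%:R) + m x.
  rewrite -ExD; apply: le_Ex => [e|G]; first exact: planted01.
  case: (boolP (success _ _ _)) => [ok|_]; last by rewrite addr_ge0.
  rewrite -natrD ler_nat; case: (boolP (bad x G)) => //= /existsPn small.
  rewrite lt0b; apply: success_corr ok => // P'.
  by have := small P'; rewrite -ltNge.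
(* AM-GM, tight at [m x = 1 / 400]: it replaces the square root in the change of measure by a bound
   that can be summed over [x]. *)
have m_le x : m x <= 200 * m x ^+ 2 + 1 / 800.
  by have := sqr_ge0 (m x - 1 / 400); nra.
set q := Num.trunc (c * (n%:R / eps ^+ 2)).
have q_ge0 : 0 <= c * (n%:R / eps ^+ 2).
  by rewrite mulr_ge0 // divr_ge0 // sqr_ge0.
have tree_q G : (queries t G <= q)%N by rewrite truncn_ge_nat.
have q_le : q%:R <= c * (n%:R / eps ^+ 2) by rewrite truncn_le.
have D0 : 0 <= 4 * d ^+ 2 by rewrite mulr_ge0 // sqr_ge0.
set K := (1 + 4 * d ^+ 2) ^+ q.
have K0 : 0 <= K by rewrite exprn_ge0 // addr_ge0.
(* [4 * d ^+ 2 = 64 * 64 * eps ^+ 2] cancels the [eps ^+ 2] in the query bound. *)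
have K_le : K <= expR (n%:R / 36).
  apply: (@le_trans _ _ (expR (4 * d ^+ 2 * q%:R))).
    rewrite expRM_natr; apply: lerXn2r; rewrite ?nnegrE ?expR_ge0 ?addr_ge0 //.
    exact: expR_ge1Dx.
  rewrite ler_expR.
  apply: (le_trans (ler_wpM2l D0 q_le)).
  have -> : 4 * d ^+ 2 * (c * (n%:R / eps ^+ 2)) = 64 * 64 * c * n%:R.
    by rewrite /d; field; rewrite gt_eqF.
  by have := ler_wpM2r (ler0n R n) c_le; lra.
have m2_le x : m x ^+ 2 <= K * Ex (@fair R n) (fun G => (good x (output t G))%:R).
  apply: tree_change_of_measure => // e; exact: planted_fresh.
have fair01 (e : vpair n) : 0 <= fair R e <= 1 by rewrite /fair; lra.
have sum_m2 : \sum_(x in balanced n) m x ^+ 2 <= #|balanced n|%:R / 400 / 400.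
  apply: (@le_trans _ _
      (\sum_x K * Ex (@fair R n) (fun G => (good x (output t G))%:R))).
    rewrite big_mkcond; apply: ler_sum => x _; case: ifP => _ //.
    by rewrite mulr_ge0 // Ex_ge0.
  rewrite -big_distrr -Ex_sum /=.
  (* Under [fair] the graph does not depend on [x]: for each fixed graph, [corr_tail] bounds the
     number of [x] correlated with the output. *)
  apply: (@le_trans _ _ (expR (n%:R / 36) * (2 ^+ n * (2 * expR (- (n%:R / 18)))))).
    apply: ler_pM => //; first by apply: Ex_ge0 => // G; apply: sumr_ge0.
    rewrite -[leRHS](Ex_cst (@fair R n)); apply: le_Ex => // G.
    exact: corr_tail.
  have -> : expR (n%:R / 36) * (2 ^+ n * (2 * expR (- (n%:R / 18)))) =
      2 ^+ n * (2 * expR (- (n%:R / 36))) :> R.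
    have -> : - (n%:R / 36) = n%:R / 36 + - (n%:R / 18) :> R by field.
    by rewrite expRD; ring.
  apply: (@le_trans _ _ (n.+1%:R * #|balanced n|%:R * (2 * expR (- (n%:R / 36))))).
    apply: ler_wpM2r; first by rewrite mulr_ge0 // expR_ge0.
    by rewrite -natrX -natrM ler_nat card_balanced.
  set B := #|_|%:R; have B0 : 0 <= B by rewrite /B.
  by rewrite (mulrC _ B); have := ler_wpM2l B0 n_b; lra.
(* The total per [x] is 1/400 + 1/800 + 1/800 = 1/200 on average. *)
apply: (@le_trans _ _ (\sum_(x in balanced n)
    (1 / 400 + (200 * m x ^+ 2 + 1 / 800)))).
  apply: ler_sum => x _; apply: le_trans (split_success x) _.
  exact: lerD.
have sum_cst k : \sum_(x in balanced n) k = #|balanced n|%:R * k :> R.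
  by rewrite sumr_const mulr_natl.
rewrite !big_split /= !sum_cst -(mulr_sumr _ _ _ 200).
by move: sum_m2; set B := #|_|%:R; set S := \sum_(_ in _) _; lra.
Qed.

End Deterministic.

Local Open Scope classical_set_scope.

(** * Randomized algorithms *)

(** Integrates a bound valid for every coin outcome, exchanging the finite sum with the integral. *)
Lemma weighted_prob_le (d : measure_display) (T : measurableType d)
  (R : realType) (P : probability T R) (I : finType) (alpha : I -> R)
  (A : I -> set T) (C : R) :
  (forall i, measurable (A i)) -> (forall i, 0 <= alpha i) ->
  (forall w, \sum_i alpha i * (\1_(A i) w) <= C) ->
  (\sum_i (alpha i)%:E * P (A i) <= C%:E)%E.
Proof.
move=> mA a0 aC.
have mf i : measurable_fun [set: T] (fun w => (alpha i * \1_(A i) w)%:E).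
  by apply/measurable_EFinP; apply: measurable_funM.
have f0 i w : [set: T] w -> (0 <= (alpha i * \1_(A i) w)%:E)%E.
  by move=> _; rewrite lee_fin mulr_ge0.
have -> : (\sum_i (alpha i)%:E * P (A i))%E =
    (\int[P]_w (\sum_i (alpha i * \1_(A i) w)%:E))%E.
  rewrite ge0_integral_sum //; apply: eq_bigr => i _.
  under eq_integral do rewrite EFinM.
  rewrite ge0_integralZl_EFin //; last first.
    by apply/measurable_EFinP.
  by rewrite integral_indic // setIT.
apply: (@le_trans _ _ (\int[P]_w (cst C%:E w))%E).
  apply: ge0_le_integral => //.
  - by move=> w _; apply: sume_ge0 => i _; apply: f0.
  - exact: emeasurable_sum.
  - by move=> w _; rewrite sumEFin lee_fin.
by rewrite integral_cst // [X in (_ * X)%E]probability_setT mule1.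
Qed.

(** Below the bound, every coin outcome gives a tree of average success at most 1/200 on planted
    graphs, whereas success above 1/100 on every graph survives averaging. *)
Lemma query_complexity_ge (R : realType) (n : nat) (Pi : rand_algorithm R n)
  (good : sgraph n -> vcut n -> Prop) (s eps c : R) :
  `|s| = 1 -> 0 < eps < 1 / 1000 -> 8 <= eps ^+ 2 * n%:R ->
  0 <= c -> 64 * 64 * c <= 1 / 36 ->
  2 * expR (- n%:R) <= 1 / 400 :> R ->
  n.+1%:R * (2 * expR (- (n%:R / 36))) <= 1 / 400 / 400 :> R ->
  (forall x G P, x \in balanced n -> good G P -> success s eps x G P) ->
  (forall G, ((1 / 100)%:E < output_prob Pi G (good G))%E) ->
  ((c * (n%:R / eps ^+ 2))%:E <= query_complexity Pi)%E.
Proof.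
move=> s1 eps01 eps_n c0 c_le n_a n_b good_success solves.
rewrite leNgt; apply/negP => qc.
have tq w G : (queries (coin_tree Pi w) G)%:R <= c * (n%:R / eps ^+ 2).
  rewrite -lee_fin; apply: le_trans (ltW qc); apply: ereal_sup_ubound.
  by exists w, G.
have d01 : 0 <= 32 * eps <= 1 / 2 by lra.
(* The planted mixture, left unnormalised with total mass [#|balanced n|]. *)
pose alpha G := \sum_(x in balanced n) wt (planted s (32 * eps) x) G.
have alpha0 G : 0 <= alpha G.
  by apply: sumr_ge0 => x _; apply: wt_ge0 => e; apply: planted01.
have sum_alpha : \sum_G alpha G = #|balanced n|%:R.
  rewrite exchange_big -sumr_const; apply: eq_bigr => x _ /=.
  rewrite -[RHS](Ex_cst (planted s (32 * eps) x)).
  by apply: eq_bigr => G _; rewrite mulr1.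
pose A G := [set w | good G (output (coin_tree Pi w) G)].
have mA G : measurable (A G).
  exact: (@coin_tree_measurable _ _ Pi [set t | good G (output t G)]).
have det w : \sum_G alpha G * (\1_(A G) w) <= #|balanced n|%:R / 200.
  apply: le_trans (tree_success_le c0 c_le s1 eps01 eps_n (tq w) n_a n_b).
  rewrite exchange_big; apply: ler_sum => G _ /=.
  rewrite mulr_suml; apply: ler_sum => x xb.
  apply: ler_wpM2l; first by apply: wt_ge0 => e; apply: planted01.
  rewrite indicE ler_nat; case: (boolP (w \in A G)) => // /set_mem wA.
  by rewrite (good_success x G).
have := weighted_prob_le (coin_law Pi) mA alpha0 det; apply/negP; rewrite -ltNge.
have B0 : 0 < #|balanced n|%:R :> R.
  rewrite ltr0n lt0n; apply: contraTneq (card_balanced n) => ->.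
  by rewrite muln0 -ltnNge expn_gt0.
apply: (@lt_le_trans _ _ (\sum_G alpha G * (1 / 100))%:E).
  by rewrite -mulr_suml sum_alpha lte_fin; lra.
rewrite -sumEFin; apply: lee_sum => G _.
by rewrite EFinM; apply: lee_wpmul2l; [rewrite lee_fin | apply: ltW (solves G)].
Qed.

(** * (Near-)optimal cuts and bisections succeed against the planted cut *)

Lemma balanced_sgsum (R : realType) (n : nat) (x : vcut n) :
  x \in balanced n -> sgsum R x ^+ 2 <= 1.
Proof.
rewrite inE => /eqP xn; rewrite sgsumE xn -[n in X in _ - X]odd_double_half.
rewrite -mulr_natr -natrM muln2 natrD opprD addrCA subrr addr0 sqrrN.
by case: (odd n); rewrite ?expr1n ?expr0n.
Qed.

Lemma bisection_sgsum (R : realType) (n : nat) (P : vcut n) :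
  bisection P -> sgsum R P = 0.
Proof.
move=> /eqP Pn; rewrite sgsumE -[X in _ - X%:R]Pn -mulr_natr -natrM muln2.
exact: subrr.
Qed.

Lemma balanced_bisection (n : nat) (x : vcut n) :
  ~~ odd n -> x \in balanced n -> bisection x.
Proof.
move=> nev; rewrite inE => /eqP xn; rewrite /bisection xn.
by rewrite -[eqbRHS]odd_double_half (negbTE nev).
Qed.

Lemma near_max_cut_success (R : realType) (n : nat) (eps : R) x
    (G : sgraph n) P :
  x \in balanced n -> near_max_cut eps G P -> success 1 eps x G P.
Proof.
move=> xb near; apply/andP; rewrite !mul1r; split.
  apply: le_trans near; rewrite lerD2r ler_nat.
  exact: (@leq_bigmax _ (fun P => cut_size G P) x).
by apply: le_trans (balanced_sgsum R xb); rewrite gerBl sqr_ge0.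
Qed.

Lemma min_bisection_le (n : nat) (G : sgraph n) (P : vcut n) :
  bisection P -> (min_bisection G <= cut_size G P)%N.
Proof.
move=> Pb; rewrite /min_bisection.
have := mem_index_enum P; elim: (index_enum _) => //= Q r IH; rewrite inE big_cons.
case/orP => [/eqP <-|/IH h]; first by rewrite Pb geq_minl.
by case: ifP => // _; rewrite geq_min h orbT.
Qed.

(** For even n the planted [x] is itself a bisection, so it bounds the minimum, and both imbalances
    vanish. *)
Lemma near_min_bisection_success (R : realType) (n : nat) (eps : R) x
    (G : sgraph n) P :
  ~~ odd n -> x \in balanced n -> near_min_bisection eps G P ->
  success (-1) eps x G P.
Proof.
move=> nev xb [Pb near]; have xbis := balanced_bisection nev xb.
apply/andP; rewrite !bisection_sgsum // subrr mulr0 ler01; split=> //.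
by have := min_bisection_le G xbis; rewrite -(ler_nat R); move: near; lra.
Qed.

(** * Numerical estimates for large n *)

Lemma expR_decay (R : realType) : exists N : R, forall n : nat, N <= n%:R ->
  2 * expR (- n%:R) <= 1 / 400 :> R /\
  n.+1%:R * (2 * expR (- (n%:R / 36))) <= 1 / 400 / 400 :> R.
Proof.
(* [M] makes (n/72)^2, a lower bound for exp(n/36), exceed 2 (n + 1) 400^2, using n + 1 <= 2n. *)
pose M : R := 400 * 400 * 4 * 72 * 72 + 1; exists M => n nM.
have M1 : 800 <= M by rewrite /M; lra.
have e1 := expR_ge1Dx (n%:R : R); have e2 := expR_ge1Dx (n%:R / 72 : R).
have n0 := ler0n R n.
have E36 : expR (n%:R / 36) = expR (n%:R / 72) ^+ 2 :> R.
  by rewrite expr2 -expRD; congr expR; field.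
split; rewrite expRN.
  by rewrite ler_pdivrMr ?expR_gt0 //; lra.
rewrite mulrA ler_pdivrMr ?expR_gt0 // E36.
have sq : (n%:R / 72) ^+ 2 <= expR (n%:R / 72) ^+ 2 :> R.
  by apply: lerXn2r; rewrite ?nnegrE ?expR_ge0 ?divr_ge0 //; lra.
apply: (@le_trans _ _ (1 / 400 / 400 * (n%:R / 72) ^+ 2)); last first.
  by rewrite ler_pM2l //; lra.
have : M * n%:R <= n%:R ^+ 2 by rewrite expr2 ler_wpM2r.
rewrite -natr1 /M; lra.
Qed.

(** Ratio at least 3 gives eps^2 n >= 9 ln n, and n >= e gives ln n >= 1. *)
Lemma eps_lower_bound (R : realType) (n : nat) (eps : R) :
  expR 1 <= n%:R :> R -> 3 <= eps / Num.sqrt (ln n%:R / n%:R) ->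
  0 < eps /\ 8 <= eps ^+ 2 * n%:R.
Proof.
move=> en h.
have n0 : 0 < n%:R :> R by apply: lt_le_trans en; apply: expR_gt0.
have ln1 : 1 <= ln n%:R :> R.
  by rewrite -[leLHS](expRK (R := R)) ler_ln // posrE ?expR_gt0.
have r0 : 0 < ln n%:R / n%:R :> R by rewrite divr_gt0 // (lt_le_trans _ ln1).
have s0 : 0 < Num.sqrt (ln n%:R / n%:R) :> R by rewrite sqrtr_gt0.
have s2 : Num.sqrt (ln n%:R / n%:R) ^+ 2 * n%:R = ln n%:R :> R.
  by rewrite sqr_sqrtr ?ltW // divfK // gt_eqF.
move: h; rewrite ler_pdivlMr // => h.
have eps0 : 0 < eps by apply: lt_le_trans h; rewrite mulr_gt0.
split=> //; apply: (@le_trans _ _ ((3 * Num.sqrt (ln n%:R / n%:R)) ^+ 2 * n%:R)).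
  by rewrite exprMn -mulrA s2; lra.
apply: ler_wpM2r; first exact: ltW.
by apply: lerXn2r; rewrite ?nnegrE ?mulr_ge0 // ltW.
Qed.

(** * The lower bound for both problems *)

Theorem theoremC1 (R : realType) :
  exists2 c : R, 0 < c &
    forall eps : nat -> R,
      (fun n : nat => eps n / Num.sqrt (ln n%:R / n%:R)) @ \oo --> +oo ->
      (forall n : nat, eps n < 1 / 1000) ->
      exists n0 : nat, forall n : nat, (n0 <= n)%N ->
        (forall Pi : rand_algorithm R n,
           solves_max_cut Pi (eps n) ->
           ((c * (n%:R / eps n ^+ 2))%:E <= query_complexity Pi)%E) /\
        (~~ odd n ->
         forall Pi : rand_algorithm R n,
           solves_min_bisection Pi (eps n) ->
           ((c * (n%:R / eps n ^+ 2))%:E <= query_complexity Pi)%E).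
Proof.
(* Small enough for [64 * 64 * c <= 1 / 36]. *)
exists (1 / 400 / 400); first by lra.
move=> eps /cvgryPge/(_ 3)[N0 _ eps3] eps_lt.
have [M decay] := expR_decay R.
pose b (z : R) := Num.bound `|z|.
exists (N0 + (b M + b (expR 1)))%N => n n_ge.
have nN : (N0 <= n)%N by apply: leq_trans n_ge; apply: leq_addr.
have above (z : R) : (b z <= b M + b (expR 1))%N -> z <= n%:R.
  move=> zn; apply: le_trans (ler_norm z) _.
  apply: le_trans (ltW (archi_boundP (normr_ge0 z))) _; rewrite ler_nat.
  by apply: leq_trans zn _; apply: leq_trans n_ge; apply: leq_addl.
have [eps0 eps_n] := eps_lower_bound (above _ (leq_addl _ _)) (eps3 n nN).
have [n_a n_b] := decay n (above _ (leq_addr _ _)).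
have eps01 : 0 < eps n < 1 / 1000 by rewrite eps0 eps_lt.
have c_le : 64 * 64 * (1 / 400 / 400) <= 1 / 36 :> R by lra.
have c0 : 0 <= 1 / 400 / 400 :> R by lra.
split=> [Pi solves|nev Pi solves].
  apply: (query_complexity_ge (normr1 R) eps01 eps_n c0 c_le n_a n_b _ solves).
  exact: near_max_cut_success.
have s1 : `|- 1 : R| = 1 by rewrite normrN normr1.
apply: (query_complexity_ge s1 eps01 eps_n c0 c_le n_a n_b _ solves).
by move=> x G P; apply: near_min_bisection_success.
Qed.
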